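(* Consider the model with inequalities only ($k=p$). Part 1. For all $\theta\in\Theta$ and $n\in\mathbb N$, $$\hat J_L(\theta)\subseteq\hat J_{SN}(\theta)\qquad(\ast)$$ implies $$P\big(T_n(\theta)>c_n^{SN,L}(\theta,\alpha)\big)\ \ge\ P\big(T_n(\theta)>c_n^{SN,2S}(\theta,\alpha)\big).$$ Part 2. In turn, $(\ast)$ is implied by $$\Phi^{-1}(1-\beta_n/p)\sqrt{M_{n,2+\delta}^2n^{-\delta/(2+\delta)}-n^{-1}}\ \ge\ (1+3\varepsilon/4)\sqrt{1-\big(\Phi^{-1}(1-\beta_n/p)\big)^2/n},$$ where $\varepsilon>0$ is the constant appearing in the definition of $\lambda_n$.
   Context: Setting. $\Theta\subseteq\mathbb{R}^q$; $p>1$ is an integer and $k=p$. For each $\theta\in\Theta$, $X_1(\theta),\dots,X_n(\theta)$ are i.i.d. $p$-dimensional random vectors distributed according to $P$, with components $X_{ij}(\theta)$, $\mu_j(\theta)=E[X_{1j}(\theta)]$, $\sigma_j^2(\theta)=\mathrm{Var}[X_{1j}(\theta)]>0$, $Z_{ij}(\theta)=(X_{ij}(\theta)-\mu_j(\theta))/\sigma_j(\theta)$. For $\delta\in(0,1]$, $M_{n,2+\delta}=\max_{j\le p}\sup_{\theta\in\Theta}(E|Z_{1j}(\theta)|^{2+\delta})^{1/(2+\delta)}$ (finite). Sample quantities: $\hat\mu_j(\theta)=n^{-1}\sum_{i}X_{ij}(\theta)$, $\hat\sigma_j^2(\theta)=n^{-1}\sum_i(X_{ij}(\theta)-\hat\mu_j(\theta))^2$,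 with the convention $x/0=\infty\cdot 1[x>0]-\infty\cdot1[x<0]$ (with $0\cdot\infty=0$). Test statistic: $T_n(\theta)=\max_{j=1,\dots,p}\sqrt n\hat\mu_j(\theta)/\hat\sigma_j(\theta)$. $\alpha\in(0,0.5)$ is the significance level and $\{\beta_n\}_{n\ge1}$ is an arbitrary sequence of constants in $(0,\alpha/2)$. $\Phi$ is the standard normal cdf. Self-normalized critical values: for an integer $d\ge 0$ and $a\in(0,1)$, $c_n^{SN}(d,a)=0$ if $d=0$ and $c_n^{SN}(d,a)=\Phi^{-1}(1-a/d)\big/\sqrt{1-(\Phi^{-1}(1-a/d))^2/n}$ if $d>0$. One-step: $c_n^{SN,1S}(a)=c_n^{SN}(p,a)$. All critical values are understood to be well defined, i.e. the expressions under the square roots are positive. Two-step SN method: $\hat J_{SN}(\theta)=\{j\in\{1,\dots,p\}:\sqrt n\hat\mu_j(\theta)/\hat\sigma_j(\theta)>-2c_n^{SN,1S}(\beta_n)\}$ and $c_n^{SN,2S}(\theta,\alpha)=c_n^{SN}(|\hat J_{SN}(\theta)|,\alpha-2\beta_n)$. Two-step Lasso SN method: $\lambda_n=(4/3+\varepsilon)n^{-1/2}(M_{n,2+\delta}^2n^{-\delta/(2+\delta)}-n^{-1})^{-1/2}$ with $\varepsilon>0$ arbitrary, $\hat J_L(\theta)=\{j\in\{1,\dots,p\}:\hat\mu_j(\theta)/\hat\sigma_j(\theta)\ge-3\lambda_n/2\}$ and $c_n^{SN,L}(\theta,\alpha)=c_n^{SN}(|\hat J_L(\theta)|,\alpha)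$.
   Formalization: In Part 2, when the displayed inequality holds with equality, the inclusion (∗) is claimed only at sample points where no coordinate has mean/standard-deviation ratio exactly −3λ_n/2; at such a tie (∗) fails, since one set uses ≥ and the other >. *)

(* Defs.v *)
From HB Require Import structures.
From mathcomp Require Import all_boot all_order all_algebra.
From mathcomp Require Import all_classical all_reals all_analysis.

Set Implicit Arguments.
Unset Strict Implicit.
Unset Printing Implicit Defensive.

Import Order.TTheory GRing.Theory Num.Theory.
Import numFieldNormedType.Exports.

Local Open Scope classical_set_scope.
Local Open Scope ring_scope.

Section standard_normal.
Context {R : realType}.

Definition Phi (x : R) : R := fine (normal_prob 0 1 `]-oo, x]).

(* Only meaningful for 0 < u < 1, where Phi x = u has exactly one solution. *)
Definition Phi_inv (u : R) : R := xget 0 [set x | Phi x = u].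

End standard_normal.

Section iid.
Context {d d' : measure_display} {T : measurableType d}
  {T' : measurableType d'} {R : realType} (P : probability T R).

Definition mutually_independent (n : nat) (X : 'I_n -> {RV P >-> T'}) : Prop :=
  forall (I : {set 'I_n}) (A : 'I_n -> set T'),
    (forall i, measurable (A i)) ->
    P (\bigcap_(i in [set` I]) (X i @^-1` A i)) =
    (\prod_(i in I) P (X i @^-1` A i))%E.

Definition identically_distributed (n : nat) (X : 'I_n -> {RV P >-> T'}) :
    Prop :=
  forall (i j : 'I_n) (A : set T'), measurable A ->
    distribution P (X i) A = distribution P (X j) A.

Definition iid (n : nat) (X : 'I_n -> {RV P >-> T'}) : Prop :=
  mutually_independent X /\ identically_distributed X.

End iid.

(* Y is a random vector playing the role of X_1(theta); j is a coordinate. *)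
Section population.
Context {d : measure_display} {T : measurableType d} {R : realType}
  (P : probability T R) {p : nat}.
Implicit Types (Y : T -> p.-tuple R) (j : 'I_p).

Definition coordinate Y j : T -> R := fun w => tnth (Y w) j.

Definition mean Y j : R := fine 'E_P[coordinate Y j].

Definition stddev Y j : R := Num.sqrt (fine 'V_P[coordinate Y j]).

Definition standardized Y j : T -> R :=
  fun w => (coordinate Y j w - mean Y j) / stddev Y j.

(* M_{n, 2 + delta}; the base -oo is harmless because p > 0 in use. *)
Definition moment_bound (q : nat) (Theta : set 'rV[R]_q)
    (Y : 'rV[R]_q -> T -> p.-tuple R) (delta : R) : \bar R :=
  (\big[maxe/-oo]_(j < p)
    ereal_sup
      [set poweR 'E_P[fun w => (`|standardized (Y theta) j w| `^ (2 + delta))%R]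
             (2 + delta)^-1%R | theta in Theta])%E.

End population.

Section sample.
Context {R : realType}.

(* x / y with x / 0 = +oo if x > 0, -oo if x < 0, and 0 / 0 = 0. *)
Definition ediv (x y : R) : \bar R :=
  if y != 0 then (x / y)%:E
  else if 0 < x then +oo%E
  else if x < 0 then -oo%E
  else 0%E.

Context {n p : nat}.
Implicit Types (x : 'I_n -> p.-tuple R) (j : 'I_p).

Definition sample_mean x j : R := n%:R^-1 * \sum_(i < n) tnth (x i) j.

Definition sample_stddev x j : R :=
  Num.sqrt (n%:R^-1 * \sum_(i < n) (tnth (x i) j - sample_mean x j) ^+ 2).

Definition t_ratio x j : \bar R :=
  ediv (Num.sqrt n%:R * sample_mean x j) (sample_stddev x j).

Definition test_stat x : \bar R := (\big[maxe/-oo]_(j < p) t_ratio x j)%E.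

End sample.

Section critical_values.
Context {R : realType}.

(* The quantity under the square root in c_n^{SN}(m, a), m > 0. *)
Definition sn_radicand (n m : nat) (a : R) : R :=
  1 - Phi_inv (1 - a / m%:R) ^+ 2 / n%:R.

Definition c_sn (n m : nat) (a : R) : R :=
  if m == 0%N then 0
  else Phi_inv (1 - a / m%:R) / Num.sqrt (sn_radicand n m a).

Definition lasso_radicand (n : nat) (M delta : R) : R :=
  M ^+ 2 * n%:R `^ (- (delta / (2 + delta))) - n%:R^-1.

Definition lasso_penalty (n : nat) (M delta eps : R) : R :=
  (4 / 3 + eps) * n%:R `^ (- (1 / 2))
    * lasso_radicand n M delta `^ (- (1 / 2)).

Context {n p : nat}.
Implicit Types x : 'I_n -> p.-tuple R.

Definition J_SN x (beta : R) : {set 'I_p} :=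
  [set j | ((- (2 * c_sn n p beta))%:E < t_ratio x j)%E].

Definition J_L x (lambda : R) : {set 'I_p} :=
  [set j | ((- (3 * lambda / 2))%:E
              <= ediv (sample_mean x j) (sample_stddev x j))%E].

Definition c_sn_2S x (alpha beta : R) : R :=
  c_sn n #|J_SN x beta| (alpha - 2 * beta).

Definition c_sn_L x (alpha lambda : R) : R := c_sn n #|J_L x lambda| alpha.

(* All critical values the two procedures can produce are well defined:
   selection sets may have any size m <= p. *)
Definition well_defined_critical_values (M delta alpha beta : R) : Prop :=
  [/\ 0 < sn_radicand n p beta,
      (forall m : nat, (0 < m <= p)%N ->
         0 < sn_radicand n m (alpha - 2 * beta)),
      (forall m : nat, (0 < m <= p)%N -> 0 < sn_radicand n m alpha)
    & 0 < lasso_radicand n M delta].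

End critical_values.
Arguments well_defined_critical_values {R} n p.

(* Main.v *)
Require Import Defs.
From HB Require Import structures.
From mathcomp Require Import all_boot all_order all_algebra.
From mathcomp Require Import all_classical all_reals all_analysis.
From mathcomp Require Import measurable_realfun ring lra.

Set Implicit Arguments.
Unset Strict Implicit.
Unset Printing Implicit Defensive.

Import Order.TTheory GRing.Theory Num.Theory.
Import numFieldNormedType.Exports.

Local Open Scope classical_set_scope.
Local Open Scope ring_scope.

(** Both critical values are of the form [c_sn n m a], with [m] the number of
    selected inequalities. The quantile level [1 - a / m] increases when [m]
    grows or [a] shrinks, the normal quantile is monotone, and
    [t |-> t / sqrt (1 - t ^ 2 / n)] is monotone on nonnegative arguments; since
    [a < 1 / 2] all quantiles involved are nonnegative, which also makes the
    value 0 attached to an empty selection the smallest one. Hence [c_sn] is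
    monotone ([le_c_sn]). If the Lasso selects fewer inequalities, its critical
    value, computed at the larger level [alpha > alpha - 2 * beta n], is
    therefore at most the two-step one, and the two-step rejection event is
    contained, up to a null set, in the Lasso one. Comparing the probabilities
    requires the events to be measurable ([measurable_rejection]).

    For the second part, multiplying the Lasso selection rule by [sqrt n] turns
    it into a rule on the same studentized ratio as the other selection set.
    Each set then consists of the coordinates above one fixed threshold, and
    the assumed inequality says exactly that the Lasso threshold is at least as
    high as the other, once [3 / 2 * (4 / 3 + eps)] is written as
    [2 * (1 + 3 * eps / 4)] ([lasso_thresholdE]).

    The quantile facts rest on the standard normal cdf being continuous, with
    limits 0 and 1, so that every level strictly between 0 and 1 is attained
    ([Phi_surj]), and on its value at 0 being 1/2 ([Phi0]). *)

(** * The standard normal quantile function *)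

Section standard_normal_cdf.
Context {R : realType}.
Implicit Types x u v : R.

Lemma EFin_Phi x : (Phi x)%:E = normal_prob 0 1 `]-oo, x].
Proof. by rewrite /Phi fineK// fin_num_measure. Qed.

(* Under the normal distribution the identity is a normal random variable, so
   monotonicity and limits of its cdf are those of [Phi]. *)
Let idR : measurableTypeR R -> R := idfun.

#[local] HB.instance Definition _ :=
  @isMeasurableFun.Build _ _ _ _ idR (@measurable_id _ _ setT).

Let cdf_idR := cdf (idR : {RV (normal_prob (0 : R) 1) >-> R}).

Let Phi_cdf : @Phi R = fine \o cdf_idR.
Proof. by []. Qed.

Lemma le_Phi x y : x <= y -> Phi x <= Phi y.
Proof.
move=> xy; rewrite Phi_cdf fine_le ?fin_num_measure//.
exact: cdf_nondecreasing.
Qed.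

(** The density is continuous, so its indefinite integral is differentiable. *)
Lemma continuous_Phi : continuous (@Phi R).
Proof.
move=> x; apply: differentiable_continuous; apply/derivable1_diffP.
have [] // := @continuous_FTC1 R (normal_pdf 0 1) -oo%O x (x + 1).
- by rewrite ltrDl.
- by apply: integrableS (integrable_normal_pdf 0 1).
- by rewrite ltNyr.
- by apply: continuous_normal_pdf; rewrite oner_eq0.
Qed.

(** The limits of the cdf bracket the level; the intermediate value theorem does
    the rest. *)
Lemma Phi_surj u : 0 < u < 1 -> exists x, Phi x = u.
Proof.
move=> /andP[u0 u1].
have PhiNy : @Phi R @ -oo --> (0 : R).
  by rewrite Phi_cdf; apply: fine_cvg; exact: cvg_cdfNy0.
have Phiy : @Phi R @ +oo --> (1 : R).
  by rewrite Phi_cdf; apply: fine_cvg; exact: cvg_cdfy1.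
have [a Pa] := filter_ex (cvgr_lt _ PhiNy _ u0).
have [b Pb] := filter_ex (cvgr_gt _ Phiy _ u1).
have ab : a <= b.
  by rewrite leNgt; apply/negP => /ltW/le_Phi; lra.
have [||c _ <-] := @IVT R Phi a b u ab; last by exists c.
  exact/continuous_subspaceT/continuous_Phi.
by rewrite ge_min le_max (ltW Pa) (ltW Pb) orbT.
Qed.

(** The density is even, so the two half-lines have equal mass. *)
Lemma Phi0 : Phi (0 : R) = 2^-1.
Proof.
have pdfN : normal_pdf (0 : R) 1 \o -%R = normal_pdf 0 1.
  apply/funext => x; rewrite /= !normal_pdfE ?oner_eq0//.
  by rewrite /normal_fun !subr0 sqrrN.
have tail : normal_prob (0 : R) 1 `]0, +oo[ = (Phi 0)%:E.
  have := @ge0_integration_by_substitutionNy R (normal_pdf 0 1) 0.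
  rewrite oppr0 pdfN EFin_Phi /normal_prob => ->.
  - rewrite integral_itv_obnd_cbnd//.
    apply/measurable_EFinP; apply: measurable_funTS.
    exact: measurable_normal_pdf.
  - apply: continuous_subspaceT; apply: continuous_normal_pdf.
    by rewrite oner_eq0.
  - by move=> x _; exact: normal_pdf_ge0.
suff : (Phi 0 + Phi 0)%:E = 1%E :> \bar R by case; lra.
rewrite EFinD -{2}tail EFin_Phi -(probability_setT (normal_prob (0 : R) 1)).
rewrite -(setUv `]-oo, 0%R]) setCitvl measureU//.
by rewrite -setCitvl setICr.
Qed.

Lemma Phi_invK u : 0 < u < 1 -> Phi (Phi_inv u) = u.
Proof.
move=> /Phi_surj[x xu]; rewrite /Phi_inv; case: xgetP => [y _ //|/(_ x)].
by move/(_ xu).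
Qed.

(** Monotonicity of [Phi] transfers to any of its right inverses. *)
Lemma le_Phi_inv u v : 0 < u -> u <= v -> v < 1 -> Phi_inv u <= Phi_inv v.
Proof.
move=> u0; rewrite le_eqVlt => /predU1P[->//|uv v1].
rewrite leNgt; apply/negP => /ltW/le_Phi.
by rewrite !Phi_invK; lra.
Qed.

Lemma Phi_inv_gt0 u : 2^-1 < u < 1 -> 0 < Phi_inv u.
Proof.
move=> u1; rewrite ltNge; apply/negP => /le_Phi.
by rewrite Phi_invK ?Phi0; lra.
Qed.

End standard_normal_cdf.

(** * Monotonicity of the self-normalized critical values *)

Section monotone_critical_values.
Context {R : realType}.
Implicit Types (n m : nat) (a : R).

Lemma le_self_normalized (N z1 z2 : R) : 0 < N -> 0 <= z1 <= z2 ->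
  0 < 1 - z2 ^+ 2 / N ->
  z1 / Num.sqrt (1 - z1 ^+ 2 / N) <= z2 / Num.sqrt (1 - z2 ^+ 2 / N).
Proof.
move=> N0 /andP[z10 z12] r2.
have r12 : 1 - z2 ^+ 2 / N <= 1 - z1 ^+ 2 / N.
  by rewrite lerD2l lerN2 ler_pM2r ?invr_gt0// ler_sqr ?nnegrE// (le_trans z10).
have r1 := lt_le_trans r2 r12.
apply: ler_pM => //.
by rewrite lef_pV2 ?posrE ?sqrtr_gt0// ler_wsqrtr.
Qed.

(** A level [a < 1 / 2] split among [m] inequalities leaves each tail below 1/2,
    hence a positive quantile. *)
Lemma Phi_inv_tail_gt0 m a : (0 < m)%N -> 0 < a < 2^-1 ->
  0 < Phi_inv (1 - a / m%:R).
Proof.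
move=> m0 /andP[a0 a1]; apply: Phi_inv_gt0.
have m1 : 1 <= m%:R :> R by rewrite ler1n.
have : 0 < a / m%:R by rewrite divr_gt0// ltr0n.
have : a / m%:R <= a by rewrite ler_pdivrMr ?ltr0n// ler_peMr// ltW.
lra.
Qed.

Lemma c_sn_gt0 n m a : (0 < m)%N -> 0 < a < 2^-1 -> 0 < sn_radicand n m a ->
  0 < c_sn n m a.
Proof.
move=> m0 a0 r0; rewrite /c_sn gtn_eqF// divr_gt0 ?sqrtr_gt0//.
exact: Phi_inv_tail_gt0.
Qed.

(** The positivity of the radicand is asked only for the larger critical value:
    the radicand of the smaller one is at least as large. It is conditional
    because an empty selection involves no square root. *)
Lemma le_c_sn n m1 m2 a1 a2 : (0 < n)%N -> (m1 <= m2)%N ->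
  0 < a2 -> a2 <= a1 -> a1 < 2^-1 ->
  ((0 < m2)%N -> 0 < sn_radicand n m2 a2) ->
  c_sn n m1 a1 <= c_sn n m2 a2.
Proof.
move=> n0 m12 a20 a21 a1h rad.
have a2b : 0 < a2 < 2^-1 by rewrite a20 (le_lt_trans a21).
have a1b : 0 < a1 < 2^-1 by rewrite a1h (lt_le_trans a20).
have [m1_eq0|m1_gt0] := posnP m1.
  rewrite {1}/c_sn m1_eq0 eqxx.
  have [->|m2_gt0] := posnP m2; first by rewrite /c_sn eqxx.
  by rewrite ltW// c_sn_gt0// rad.
have m2_gt0 := leq_trans m1_gt0 m12.
rewrite /c_sn !gtn_eqF//; apply: le_self_normalized.
- by rewrite ltr0n.
- rewrite (ltW (Phi_inv_tail_gt0 _ _))//=.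
  have tail m a : (0 < m)%N -> 0 < a < 2^-1 -> 0 < a / m%:R < 1.
    move=> m0 /andP[a0 a1']; rewrite divr_gt0 ?ltr0n//=.
    rewrite ltr_pdivrMr ?ltr0n// mul1r (lt_le_trans a1')//.
    have : 1 <= m%:R :> R by rewrite ler1n.
    lra.
  have t1 := tail _ _ m1_gt0 a1b; have t2 := tail _ _ m2_gt0 a2b.
  have t21 : a2 / m2%:R <= a1 / m1%:R.
    by rewrite ler_pM ?(ltW a20)// lef_pV2 ?posrE ?ltr0n// ler_nat.
  apply: le_Phi_inv; lra.
- exact: rad.
Qed.

End monotone_critical_values.

(** * Measurability of the rejection events *)

Section measurable_rejection.
Context {d : measure_display} {T : measurableType d} {R : realType}.

(** Inversion is continuous away from 0, and the remaining point 0 is a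
    measurable set on which every function is measurable. *)
Lemma measurable_invr : measurable_fun [set: R] (@GRing.inv R).
Proof.
rewrite -(setvU [set 0]); apply/measurable_funU => //.
  exact: measurableC.
split; last exact: measurable_fun_set1.
apply: open_continuous_measurable_fun.
  apply: closed_openC; apply: accessible_closed_set1.
  exact: hausdorff_accessible.
by move=> y; rewrite inE /= => /eqP; exact: inv_continuous.
Qed.

Lemma measurable_ediv (f g : T -> R) :
  measurable_fun [set: T] f -> measurable_fun [set: T] g ->
  measurable_fun [set: T] (fun w => ediv (f w) (g w)).
Proof.
move=> mf mg; rewrite /ediv; apply: measurable_fun_ifT.
- apply: (@measurableT_comp _ _ _ _ _ _ negb) => //.
  exact: measurable_fun_eqr.
- apply/measurable_EFinP; apply: measurable_funM => //.
  by apply: (measurableT_comp measurable_invr).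
apply: measurable_fun_ifT => //; first exact: measurable_fun_ltr.
by apply: measurable_fun_ifT => //; exact: measurable_fun_ltr.
Qed.

Context {n p : nat} (X : 'I_n -> T -> p.-tuple R)
  (mX : forall i, measurable_fun [set: T] (X i)).

Let x w : 'I_n -> p.-tuple R := X ^~ w.

Lemma measurable_sample_mean j :
  measurable_fun [set: T] (fun w => sample_mean (x w) j).
Proof.
apply: measurable_funM => //; apply: measurable_sum => i.
exact: (measurableT_comp (measurable_tnth j) (mX i)).
Qed.

Lemma measurable_sample_stddev j :
  measurable_fun [set: T] (fun w => sample_stddev (x w) j).
Proof.
apply: (measurableT_comp (continuous_measurable_fun (@sqrt_continuous R))).
apply: measurable_funM => //; apply: measurable_sum => i.
apply: measurable_funX; apply: measurable_funB.
  exact: (measurableT_comp (measurable_tnth j) (mX i)).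
exact: measurable_sample_mean.
Qed.

Lemma measurable_t_ratio j :
  measurable_fun [set: T] (fun w => t_ratio (x w) j).
Proof.
apply: measurable_ediv; last exact: measurable_sample_stddev.
by apply: measurable_funM => //; exact: measurable_sample_mean.
Qed.

Lemma measurable_test_stat :
  measurable_fun [set: T] (fun w => test_stat (x w)).
Proof.
rewrite /test_stat; elim: index_enum => [|j s ih].
  by under eq_fun do rewrite big_nil; exact: measurable_cst.
under eq_fun do rewrite big_cons.
by apply: measurable_maxe => //; exact: measurable_t_ratio.
Qed.

Lemma measurable_J_SN beta j : measurable [set w | j \in J_SN (x w) beta].
Proof.
under eq_set do rewrite inE.
rewrite -[X in measurable X]setTI.
by apply: emeasurable_fun_o_infty => //; exact: measurable_t_ratio.
Qed.

Lemma measurable_J_L lambda j : measurable [set w | j \in J_L (x w) lambda].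
Proof.
under eq_set do rewrite inE.
rewrite -[X in measurable X]setTI.
apply: emeasurable_fun_c_infty => //.
apply: measurable_ediv; first exact: measurable_sample_mean.
exact: measurable_sample_stddev.
Qed.

(** A data-dependent selection takes finitely many values, so the event splits
    over the selected set; on each piece the critical value is a constant. *)
Lemma measurable_rejection (J : T -> {set 'I_p}) (c : {set 'I_p} -> R) :
  (forall j, measurable [set w | j \in J w]) ->
  measurable [set w | ((c (J w))%:E < test_stat (x w))%E].
Proof.
move=> mJ.
have -> : [set w | ((c (J w))%:E < test_stat (x w))%E] =
    \bigcup_(A in [set: {set 'I_p}])
      ((\bigcap_(j in [set: 'I_p]) [set w | (j \in J w) = (j \in A)])
       `&` [set w | ((c A)%:E < test_stat (x w))%E]).
  apply/seteqP; split=> w /=; first by move=> cw; exists (J w).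
  by move=> [A _ [JA cw]]; have -> : J w = A by apply/setP => j; exact: JA.
apply: fin_bigcup_measurable => // A _; apply: measurableI.
  apply: fin_bigcap_measurable => // j _.
  case: (j \in A); first exact: mJ.
  rewrite [X in measurable X](_ : _ = ~` [set w | j \in J w]).
    exact/measurableC/mJ.
  by apply/seteqP; split=> w /=; [move=> -> | move/negP/negbTE].
rewrite -[X in measurable X]setTI.
by apply: emeasurable_fun_o_infty => //; exact: measurable_test_stat.
Qed.

End measurable_rejection.

(** * Comparison of the two selection rules *)

Section selection.
Context {R : realType} {n p : nat}.
Implicit Types x : 'I_n -> p.-tuple R.

Lemma ediv_scale (k a b : R) : 0 < k -> ediv (k * a) b = (k%:E * ediv a b)%E.
Proof.
move=> k0; rewrite /ediv pmulr_rgt0// pmulr_rlt0//.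
case: ifP => _; first by rewrite -mulrA EFinM.
case: ifP => _; first by rewrite gt0_muley ?lte_fin.
by case: ifP => _; [rewrite gt0_muleNy ?lte_fin | rewrite mule0].
Qed.

(** The Lasso rule keeps a coordinate lying on its threshold and the other rule
    drops it, so equal thresholds give the inclusion only when no coordinate
    lies there. *)
Lemma J_L_sub_J_SN x beta lambda : (0 < n)%N ->
  3 * lambda / 2 * Num.sqrt n%:R <= 2 * c_sn n p beta ->
  (forall j, 3 * lambda / 2 * Num.sqrt n%:R < 2 * c_sn n p beta \/
     ediv (sample_mean x j) (sample_stddev x j) != (- (3 * lambda / 2))%:E) ->
  J_L x lambda \subset J_SN x beta.
Proof.
move=> n0 cl strict; apply/fintype.subsetP => j; rewrite !inE => jL.
have s0 : 0 < Num.sqrt n%:R :> R by rewrite sqrtr_gt0 ltr0n.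
rewrite /t_ratio ediv_scale//.
have thr : (- (3 * lambda / 2 * Num.sqrt n%:R))%:E =
    ((Num.sqrt n%:R)%:E * (- (3 * lambda / 2))%:E)%E :> \bar R.
  by rewrite -EFinM mulrN mulrC.
have [cl'|jN] := strict j.
  apply: (@lt_le_trans _ _ (- (3 * lambda / 2 * Num.sqrt n%:R))%:E).
    by rewrite lte_fin ltrN2.
  by rewrite thr lee_pmul2l ?lte_fin.
apply: (@le_lt_trans _ _ (- (3 * lambda / 2 * Num.sqrt n%:R))%:E).
  by rewrite lee_fin lerN2.
by rewrite thr lte_pmul2l ?lte_fin// lt_neqAle eq_sym jN.
Qed.

Lemma lasso_thresholdE (M delta eps : R) : (0 < n)%N ->
  0 < lasso_radicand n M delta ->
  3 * lasso_penalty n M delta eps / 2 * Num.sqrt n%:R =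
  2 * ((1 + 3 * eps / 4) / Num.sqrt (lasso_radicand n M delta)).
Proof.
move=> n0 r0; have n0' : 0 < n%:R :> R by rewrite ltr0n.
rewrite /lasso_penalty !powRN mul1r !powR12_sqrt ?ltW//.
have sn : Num.sqrt n%:R != 0 :> R by rewrite gt_eqF// sqrtr_gt0.
have sr : Num.sqrt (lasso_radicand n M delta) != 0.
  by rewrite gt_eqF// sqrtr_gt0.
by field; rewrite sn sr.
Qed.

End selection.

(** * Comparison of the rejection probabilities *)

Lemma le_measure_ae (d : measure_display) (T : measurableType d)
    (R : realType) (mu : {measure set T -> \bar R}) (A B : set T) :
  measurable A -> measurable B ->
  {ae mu, forall w, A w -> B w} -> (mu A <= mu B)%E.
Proof.
move=> mA mB [N [mN N0 AB]].
apply: (@le_trans _ _ (mu (B `|` N))).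
  apply: le_measure; rewrite ?inE//; first exact: measurableU.
  move=> w Aw; have [Bw|nBw] := pselect (B w); first by left.
  by right; apply: AB => /(_ Aw).
apply: (le_trans (measureU2 _ _ _)) => //.
by rewrite [X in (_ + X)%E]N0 adde0.
Qed.

Theorem theorem5p1 (R : realType) (d : measure_display) (T : measurableType d)
    (P : probability T R) (q p n : nat) (Theta : set 'rV[R]_q)
    (X : 'rV[R]_q -> 'I_n -> {RV P >-> p.-tuple R})
    (delta eps alpha : R) (beta : nat -> R)
    (p_gt1 : (1 < p)%N) (n_gt0 : (0 < n)%N) :
  let X1 := fun theta => X theta (Ordinal n_gt0) : T -> p.-tuple R in
  let M := fine (moment_bound P Theta X1 delta) in
  let lambda := lasso_penalty n M delta eps in
  let z := Phi_inv (1 - beta n / p%:R) in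
  let lhs := (1 + 3 * eps / 4) * Num.sqrt (1 - z ^+ 2 / n%:R) in
  let rhs :=
    z * Num.sqrt (M ^+ 2 * n%:R `^ (- (delta / (2 + delta))) - n%:R^-1) in
  let x := fun theta w i => X theta i w in
  0 < delta <= 1 ->
  0 < eps ->
  0 < alpha < 1 / 2 ->
  (forall m : nat, (0 < m)%N -> 0 < beta m < alpha / 2) ->
  (forall theta, Theta theta -> iid (X theta)) ->
  (forall theta j, Theta theta -> coordinate (X1 theta) j \in Lfun P 2%:E) ->
  (forall theta j, Theta theta -> (0 < 'V_P[coordinate (X1 theta) j])%E) ->
  moment_bound P Theta X1 delta \is a fin_num ->
  well_defined_critical_values n p M delta alpha (beta n) ->
  forall theta, Theta theta ->
  ({ae P, forall w, J_L (x theta w) lambda \subset J_SN (x theta w) (beta n)} ->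
   (P [set w | (c_sn_2S (x theta w) alpha (beta n))%:E
                 < test_stat (x theta w)]
    <= P [set w | (c_sn_L (x theta w) alpha lambda)%:E
                    < test_stat (x theta w)])%E)
  /\
  (lhs <= rhs ->
   forall w,
     (* J_SN is cut off strictly and J_L weakly, so when lhs = rhs a coordinate
        sitting exactly on the common threshold is in J_L but not in J_SN *)
     lhs < rhs \/
     (forall j, ediv (sample_mean (x theta w) j) (sample_stddev (x theta w) j)
                  != (- (3 * lambda / 2))%:E) ->
     J_L (x theta w) lambda \subset J_SN (x theta w) (beta n)).
Proof.
move=> X1 M lambda z lhs rhs x delta01 eps0 alpha01 beta_small _ _ _ _.
move=> [rad_beta rad_2S rad_L rad_lasso] theta _.
have /andP[b0 ba] := beta_small n n_gt0; have /andP[a0 a1] := alpha01.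
split=> [sub|le_lr w strict].
  have mX i : measurable_fun [set: T] (X theta i) by exact: measurable_funPT.
  apply: le_measure_ae.
  - apply: (@measurable_rejection _ _ _ _ _ (fun i w => X theta i w) mX
      (fun w => J_SN (x theta w) (beta n))
      (fun A => c_sn n #|A| (alpha - 2 * beta n))).
    exact: measurable_J_SN.
  - apply: (@measurable_rejection _ _ _ _ _ (fun i w => X theta i w) mX
      (fun w => J_L (x theta w) lambda) (fun A => c_sn n #|A| alpha)).
    exact: measurable_J_L.
  apply: filterS sub => w sub; apply: le_lt_trans.
  rewrite lee_fin; apply: le_c_sn => //; [|lra..|].
  - exact: subset_leq_card.
  - move=> m0; apply: rad_2S; rewrite m0/=.
    by rewrite -[leqRHS]card_ord max_card.
have sz : 0 < Num.sqrt (sn_radicand n p (beta n)) by rewrite sqrtr_gt0.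
have sl : 0 < Num.sqrt (lasso_radicand n M delta) by rewrite sqrtr_gt0.
have p_gt0 : (0 < p)%N by exact: ltnW.
have cE : c_sn n p (beta n) = z / Num.sqrt (sn_radicand n p (beta n)).
  by rewrite /c_sn gtn_eqF.
apply: J_L_sub_J_SN => // [|j].
  rewrite lasso_thresholdE// cE ler_pM2l// ler_pdivrMr//.
  by rewrite [leRHS]mulrAC ler_pdivlMr//.
case: strict => [lt_lr|jN]; [left|right; exact: jN].
rewrite lasso_thresholdE// cE ltr_pM2l// ltr_pdivrMr//.
by rewrite [ltRHS]mulrAC ltr_pdivlMr.
Qed.
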